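(* Let $d\geq 2$ and $k\geq 2d$ be integers with $\gcd(k,d)=1$. For $0\leq n\leq d-1$ put \[ c_n:=\cos\Big(\frac{2n\pi}{d}\Big),\qquad a_n:=\cos\Big(\Big\lfloor \frac{nk}{d}\Big\rfloor\frac{2\pi}{k}\Big). \] Then \[ \vartheta\big(\overline{K_{k/d}}\big)=\frac{k}{d}\sum_{n=0}^{d-1}\ \prod_{s=1}^{d-1}\frac{c_n-a_s}{1-a_s}. \]
   Context: For integers $k\geq 2d\geq 2$, the circular complete graph $K_{k/d}$ has vertex set $\{0,1,\dots,k-1\}$, two vertices $i,j$ being adjacent iff $d\leq |i-j|\leq k-d$; $\overline{K_{k/d}}$ is its complement. For a finite graph $G=(V,E)$, the Lov\'asz theta number is $\vartheta(G)=\max\{\sum_{(x,y)\in V^2}B(x,y) : B\in\mathbb{R}^{V\times V}$ symmetric positive semidefinite, $\sum_{x\in V}B(x,x)=1$, $B(x,y)=0$ for all edges $xy\in E\}$. *)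

(* Defs.v *)
From HB Require Import structures.
From mathcomp Require Import all_boot all_order all_algebra.
From mathcomp Require Import all_classical all_reals all_analysis.

Set Implicit Arguments.
Unset Strict Implicit.
Unset Printing Implicit Defensive.

Import Order.TTheory GRing.Theory Num.Theory.

Local Open Scope classical_set_scope.
Local Open Scope ring_scope.

(* A finite simple graph is a symmetric irreflexive relation on a finType. *)
Definition complement_graph (V : finType) (e : rel V) : rel V :=
  fun x y => (x != y) && ~~ e x y.

(* |i - j| is the absolute difference of naturals; k - d is truncated
   subtraction, which is harmless as d <= k is assumed. *)
Definition circular_complete (k d : nat) : rel 'I_k :=
  fun i j => (d <= `|i - j| <= k - d)%N.

Lemma circular_complete_sym k d : symmetric (@circular_complete k d).
Proof. by move=> i j; rewrite /circular_complete distnC. Qed.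

Lemma circular_complete_irr k d :
  (0 < d)%N -> irreflexive (@circular_complete k d).
Proof. by move=> d0 i; rewrite /circular_complete distnn leqNgt d0. Qed.

Lemma complement_graph_sym (V : finType) (e : rel V) :
  symmetric e -> symmetric (complement_graph e).
Proof. by move=> es x y; rewrite /complement_graph eq_sym es. Qed.

Lemma complement_graph_irr (V : finType) (e : rel V) :
  irreflexive (complement_graph e).
Proof. by move=> x; rewrite /complement_graph eqxx. Qed.

Definition sym_psd (R : realType) (V : finType) (B : V -> V -> R) : Prop :=
  (forall x y, B x y = B y x) /\
  (forall u : V -> R, 0 <= \sum_x \sum_y u x * B x y * u y).

Definition theta_feasible (R : realType) (V : finType) (e : rel V) :
    set (V -> V -> R) :=
  [set B | [/\ sym_psd B,
               \sum_x B x x = 1 &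
               forall x y, e x y -> B x y = 0]].

Definition theta_values (R : realType) (V : finType) (e : rel V) : set R :=
  [set \sum_x \sum_y B x y | B in @theta_feasible R V e].

(* t is the maximum, attained, of the semidefinite program; such a t is
   unique. *)
Definition is_lovasz_theta (R : realType) (V : finType) (e : rel V) (t : R) :
    Prop :=
  theta_values e t /\ ubound (theta_values e) t.

Lemma is_lovasz_theta_unique (R : realType) (V : finType) (e : rel V)
    (t u : R) :
  is_lovasz_theta e t -> is_lovasz_theta e u -> t = u.
Proof.
by move=> [et ut] [eu uu]; apply/eqP; rewrite eq_le uu// ut.
Qed.

(* Main.v *)
Require Import Defs.
From HB Require Import structures.
From mathcomp Require Import all_boot all_order all_algebra.
From mathcomp Require Import all_classical all_reals all_analysis.
From mathcomp Require Import ring lra zify.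

Set Implicit Arguments.
Unset Strict Implicit.
Unset Printing Implicit Defensive.

Import Order.TTheory GRing.Theory Num.Theory.

Local Open Scope ring_scope.

(* Write psi = pi u / k with d u = 1 mod k. Since floor(sk/d) = - u (sk mod d)
   mod k, the a_s with 0 < s < d are, up to order, the numbers cos(2 r psi) with
   0 < r < d, so P = prod_s (x - a_s) / (1 - a_s) is governed by the q-binomial
   theorem with q = exp(2 i psi). Its cosine coefficients v_0, ..., v_(d-1) are,
   up to a common positive factor, partial sums of the signed Gaussian binomials
   [2d-1, i], and d u = 1 mod k makes these positive for i < d. Hence:
   - B(x, y) = P(cos(2 psi (x - y))) / k is positive semidefinite and feasible,
     with value k v_0;
   - floor((d-s)k/d) = k - 1 - floor(sk/d) pairs the roots of P into
     consecutive points of the grid cos(2 pi n / k), so that P >= 0 on that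
     grid, and testing a feasible B against P gives the upper bound k v_0.
   Finally v_0 is the mean of P over the points cos(2 pi n / d), as deg P < d. *)

(** * Product formulas, and sines at integer multiples of [pi / k] *)

Lemma cosBcosD (R : realType) (x y : R) :
  cos (x - y) - cos (x + y) = 2 * (sin x * sin y).
Proof. by rewrite cosB cosD; ring. Qed.

Lemma sinDsinB (R : realType) (x y : R) :
  sin (x + y) - sin (x - y) = 2 * (cos x * sin y).
Proof. by rewrite sinB sinD; ring. Qed.

Lemma cosDcosB (R : realType) (x y : R) :
  cos (x + y) + cos (x - y) = 2 * (cos x * cos y).
Proof. by rewrite cosB cosD; ring. Qed.

Lemma sinDnpi (R : realType) (x : R) n :
  sin (x + n%:R * pi) = (-1) ^+ n * sin x.
Proof.
elim: n => [|n IH]; first by rewrite mul0r addr0 expr0 mul1r.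
by rewrite -natr1 mulrDl mul1r addrA sinDpi IH exprS mulN1r mulNr.
Qed.

Lemma sin_modn (R : realType) (k x : nat) : (0 < k)%N ->
  sin (x%:R * (pi / k%:R)) =
  (-1) ^+ (x %/ k) * sin ((x %% k)%:R * (pi / k%:R)) :> R.
Proof.
move=> k0; rewrite -sinDnpi; congr sin.
have k0' : k%:R != 0 :> R by rewrite pnatr_eq0 -lt0n.
rewrite {1}(divn_eq x k) natrD natrM; field.
exact: k0'.
Qed.

Lemma sin_pin_gt0 (R : realType) (k x : nat) : (0 < x < k)%N ->
  0 < sin (x%:R * (pi / k%:R)) :> R.
Proof.
move=> /andP[x0 xk]; have k0 : 0 < k%:R :> R by rewrite ltr0n (leq_trans x0)// ltnW.
apply: sin_gt0_pi; rewrite mulr_gt0 ?ltr0n ?divr_gt0 ?pi_gt0//=.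
by rewrite mulrA ltr_pdivrMr// mulrC ltr_pM2l ?pi_gt0// ltr_nat.
Qed.

Lemma sin_pin_ge0 (R : realType) (k x : nat) : (x <= k)%N ->
  0 <= sin (x%:R * (pi / k%:R)) :> R.
Proof.
move=> xk; have [->|k0] := posnP k; first by rewrite invr0 !mulr0 sin0.
have k0' : 0 < k%:R :> R by rewrite ltr0n.
apply: sin_ge0_pi; rewrite mulr_ge0 ?divr_ge0 ?pi_ge0//=.
by rewrite mulrA ler_pdivrMr// mulrC ler_pM2l ?pi_gt0// ler_nat.
Qed.

Lemma sin_pin_eq0 (R : realType) (k x : nat) : (0 < k)%N ->
  (sin (x%:R * (pi / k%:R)) == 0 :> R) = (k %| x)%N.
Proof.
move=> k0; rewrite sin_modn// mulf_eq0 signr_eq0 /dvdn /=.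
have [->|x0] := posnP (x %% k); first by rewrite mul0r sin0 !eqxx.
by rewrite gt_eqF//; apply: sin_pin_gt0; rewrite x0 ltn_mod.
Qed.

(** [x] and [x.+1] lie in one closed interval between consecutive multiples of [k], on which the
    sine keeps its sign. *)
Lemma sin_pinS_ge0 (R : realType) (k x : nat) : (0 < k)%N ->
  0 <= sin (x%:R * (pi / k%:R)) * sin (x.+1%:R * (pi / k%:R)) :> R.
Proof.
move=> k0; set q := (x %/ k)%N; set r := (x %% k)%N.
have rk : (r < k)%N by rewrite ltn_mod.
have shift n : sin ((n + q * k)%:R * (pi / k%:R)) =
    (-1) ^+ q * sin (n%:R * (pi / k%:R)) :> R.
  rewrite -sinDnpi; congr sin.
  have k0' : k%:R != 0 :> R by rewrite pnatr_eq0 -lt0n.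
  by rewrite natrD natrM; field.
have -> : x = (r + q * k)%N by rewrite addnC -divn_eq.
rewrite -addSn !shift mulrACA -expr2 sqrr_sign mul1r.
by rewrite mulr_ge0// sin_pin_ge0// ltnW.
Qed.

Lemma sum_cos_arith (R : realType) (N : nat) (a b : R) :
  2 * sin a * (\sum_(0 <= n < N) cos (n%:R * (2 * a) + b)) =
  sin ((2 * N%:R - 1) * a + b) - sin (b - a).
Proof.
elim: N => [|N IH].
  by rewrite big_geq// mulr0 mulr0 sub0r mulN1r [- a + b]addrC subrr.
rewrite big_nat_recr//= mulrDr IH.
have := sinDsinB (N%:R * (2 * a) + b) a.
have -> : N%:R * (2 * a) + b + a = (2 * N.+1%:R - 1) * a + b.
  by rewrite -natr1; ring.
have -> : N%:R * (2 * a) + b - a = (2 * N%:R - 1) * a + b by ring.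
lra.
Qed.

(** Indivisibility makes the factor [sin a] of [sum_cos_arith] invertible, while the two boundary
    sines agree modulo [2 * pi]. *)
Lemma sum_cos_cyclic (R : realType) (N j : nat) (b : R) : (0 < N)%N ->
  ~~ (N %| j)%N ->
  \sum_(0 <= n < N) cos (n%:R * (2 * (j%:R * (pi / N%:R))) + b) = 0.
Proof.
move=> N0; rewrite -(@sin_pin_eq0 R)// => s0.
apply/eqP; rewrite -(mulrI_eq0 _ (mulfI (_ : 2 * sin (j%:R * (pi / N%:R)) != 0))).
  rewrite sum_cos_arith.
  have -> : (2 * N%:R - 1) * (j%:R * (pi / N%:R)) + b =
      (b - j%:R * (pi / N%:R)) + (2 * j)%:R * pi.
    have N0' : N%:R != 0 :> R by rewrite pnatr_eq0 -lt0n.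
    by rewrite natrM; field.
  by rewrite sinDnpi exprM sqrrN expr1n expr1n mul1r subrr.
by rewrite mulf_neq0// pnatr_eq0.
Qed.

(** * The finite q-binomial expansion and its cosine polynomial *)

Section Gaussian.
Variables (R : realType) (d : nat) (psi : R) (D : nat -> R).
(** The recursion of the symmetric Gaussian binomials [[2d-1, i]] with sign [(-1) ^ i]. *)
Hypothesis Drec : forall i, (i < d)%N ->
  D i.+1 * sin (i.+1%:R * psi) = - (D i * sin ((2 * d%:R - 1 - i%:R) * psi)).

(* The first half of the antisymmetric expansion of
   [prod_(|j| < d) (z - q ^ j)] at [z = exp(2 i t)], [q = exp(2 i psi)]. *)
Definition half_qbinomial (t : R) : R :=
  \sum_(0 <= i < d) D i * sin ((2 * d%:R - 1 - 2 * i%:R) * t).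

(** The functional equation of the product of [sin (t + j * psi)] over [|j| < d]: shifting [t] by
    [psi] trades the lowest factor for a new top one. *)
Lemma half_qbinomial_shift t :
  half_qbinomial (t + psi) * sin (t - (d%:R - 1) * psi) =
  half_qbinomial t * sin (t + d%:R * psi).
Proof.
(* [Y] makes the difference of both sides telescope. It vanishes at 0, where its two cosines
   coincide, and at [d], where their arguments are opposite. *)
pose Y i := D i * (cos ((2 * d%:R - 2 * i%:R) * t + (d%:R - 2 * i%:R) * psi)
                   - cos ((2 * d%:R - 2 * i%:R) * t + d%:R * psi)).
have YE i : (i < d)%N -> Y i.+1 - Y i =
   2 * (D i * sin ((2 * d%:R - 1 - 2 * i%:R) * (t + psi))
        * sin (t - (d%:R - 1) * psi)
        - D i * sin ((2 * d%:R - 1 - 2 * i%:R) * t) * sin (t + d%:R * psi)).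
  move=> id.
  pose A := (2 * d%:R - 2 * i%:R - 2) * t + (d%:R - 1 - i%:R) * psi.
  pose x := (2 * d%:R - 1 - 2 * i%:R) * (t + psi).
  pose x' := (2 * d%:R - 1 - 2 * i%:R) * t.
  pose y := t - (d%:R - 1) * psi; pose y' := t + d%:R * psi.
  have YiE : Y i = D i * (cos (x + y) - cos (x' + y')).
    by rewrite /Y /x /x' /y /y'; congr (_ * (cos _ - cos _)); ring.
  have YSE : Y i.+1 = D i * (cos (x - y) - cos (x' - y')).
    have -> : Y i.+1 = 2 * (sin A * (D i.+1 * sin (i.+1%:R * psi))).
      transitivity (D i.+1 * (2 * (sin A * sin (i.+1%:R * psi)))); last by ring.
      by rewrite -cosBcosD /Y /A -natr1; congr (_ * (cos _ - cos _)); ring.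
    rewrite Drec//.
    transitivity (- (D i * (2 * (sin A * sin ((2 * d%:R - 1 - i%:R) * psi)))));
      first by ring.
    rewrite -cosBcosD -mulrN opprB /A /x /x' /y /y'.
    by congr (_ * (cos _ - cos _)); ring.
  transitivity (D i * (2 * (sin x * sin y) - 2 * (sin x' * sin y')));
    last by rewrite /x /x' /y /y'; ring.
  by rewrite -!cosBcosD YiE YSE; ring.
have Ysum : \sum_(0 <= i < d) (Y i.+1 - Y i) = 0.
  have Y0 : Y 0%N = 0.
    by rewrite /Y (_ : (d%:R - 2 * 0%:R) = d%:R :> R) ?subrr ?mulr0//; ring.
  have Yd : Y d = 0.
    rewrite /Y subrr mul0r !add0r (_ : d%:R - 2 * d%:R = - d%:R :> R); last by ring.
    by rewrite mulNr cosN subrr mulr0.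
  by rewrite telescope_sumr// Y0 Yd subrr.
apply/eqP; rewrite -subr_eq0 /half_qbinomial !mulr_suml -sumrB.
rewrite -(mulrI_eq0 _ (mulfI (_ : 2 != 0 :> R))) ?pnatr_eq0//.
apply/eqP; rewrite mulr_sumr -[RHS]Ysum; apply: eq_big_nat => i /andP[_ id].
by rewrite YE.
Qed.

(** The zero at 0 spreads by the shift relation, whose left-hand sine factor stays nonzero as long
    as [n.+1 < d]. *)
Lemma half_qbinomial_root n : (n < d)%N ->
  (forall j, (0 < j < d)%N -> sin (j%:R * psi) != 0) ->
  half_qbinomial (n%:R * psi) = 0.
Proof.
move=> + sn0; elim: n => [_|n IH nd].
  by rewrite mul0r /half_qbinomial big1// => i _; rewrite mulr0 sin0 mulr0.
have -> : n.+1%:R * psi = n%:R * psi + psi by rewrite -natr1; ring.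
have := half_qbinomial_shift (n%:R * psi).
rewrite IH ?(ltnW nd)// mul0r => /eqP; rewrite mulf_eq0 => /orP[/eqP//|].
have -> : n%:R * psi - (d%:R - 1) * psi = - ((d - n.+1)%:R * psi).
  by rewrite natrB ?(ltnW nd)// -natr1; ring.
by rewrite sinN oppr_eq0 (negbTE (sn0 _ _))//; lia.
Qed.

(** Dividing each sine of [half_qbinomial] by [sin t] gives a Dirichlet kernel, hence the partial
    sums; the factor 2 merges the frequencies [j] and [- j]. *)
Definition cos_coef (j : nat) : R :=
  (if j == 0%N then 1 else 2) * \sum_(0 <= i < d - j) D i.

Definition cos_poly (t : R) : R :=
  \sum_(0 <= j < d) cos_coef j * cos (j%:R * t).

Lemma dirichlet_kernel m (t : R) :
  sin t * (\sum_(0 <= j < m.+1) (if j == 0%N then 1 else 2) * cos (j%:R * (2 * t)))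
  = sin ((2 * m%:R + 1) * t).
Proof.
elim: m => [|m IH].
  by rewrite big_nat1 mul0r cos0 !mulr1 mulr0 add0r mul1r.
rewrite big_nat_recr//= mulrDr IH.
have := sinDsinB (m.+1%:R * (2 * t)) t.
have -> : m.+1%:R * (2 * t) + t = (2 * m.+1%:R + 1) * t by ring.
have -> : m.+1%:R * (2 * t) - t = (2 * m%:R + 1) * t by rewrite -natr1; ring.
lra.
Qed.

Lemma sin_cos_poly t : sin t * cos_poly (2 * t) = half_qbinomial t.
Proof.
pose eps (j : nat) : R := if j == 0%N then 1 else 2.
have -> : cos_poly (2 * t) = \sum_(0 <= i < d) D i *
    \sum_(0 <= j < (d - i.+1).+1) eps j * cos (j%:R * (2 * t)).
  transitivity (\sum_(0 <= j < d) \sum_(0 <= i < d | (i + j < d)%N)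
      D i * (eps j * cos (j%:R * (2 * t)))).
    apply: eq_big_nat => j /andP[_ jd].
    rewrite /cos_coef -/(eps j) mulrAC mulr_sumr [RHS]big_mkcond.
    rewrite (big_cat_nat (leq0n (d - j)) (leq_subr j d))/=.
    rewrite [X in _ = _ + X]big1_seq ?addr0; last first.
      by move=> i; rewrite mem_index_iota; case: ifP => //; lia.
    apply: eq_big_nat => i /andP[_ idj]; rewrite ifT; last by lia.
    by rewrite mulrC.
  rewrite (exchange_big_dep predT)//=; apply: eq_big_nat => i /andP[_ id].
  rewrite mulr_sumr big_mkcond.
  rewrite (big_cat_nat (leq0n (d - i)) (leq_subr i d))/=.
  rewrite [X in _ + X = _]big1_seq ?addr0; last first.
    by move=> j; rewrite mem_index_iota; case: ifP => //; lia.
  have -> : (d - i.+1).+1 = (d - i)%N by lia.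
  by apply: eq_big_nat => j /andP[_ jdi]; rewrite ifT//; lia.
rewrite mulr_sumr; apply: eq_big_nat => i /andP[_ id].
rewrite mulrCA dirichlet_kernel natrB// -natr1.
by congr (_ * sin _); ring.
Qed.

Lemma cos_poly_root n : (0 < n < d)%N ->
  (forall j, (0 < j < d)%N -> sin (j%:R * psi) != 0) ->
  cos_poly (n%:R * (2 * psi)) = 0.
Proof.
move=> /andP[n0 nd] sn0; apply/eqP.
have := sin_cos_poly (n%:R * psi); rewrite half_qbinomial_root// => /eqP.
rewrite mulf_eq0 (negbTE (sn0 _ _)) ?n0//=.
by rewrite mulrCA.
Qed.

End Gaussian.

(** * Polynomials in [cos t], factorisation by roots, signs of paired products *)

Lemma cos_natmul_poly (R : realType) n : exists p : {poly R},
  (size p <= n.+1)%N /\ forall t, p.[cos t] = cos (n%:R * t).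
Proof.
(* The Chebyshev recursion has two terms, so the induction carries two consecutive degrees. *)
suff: (exists p : {poly R},
    (size p <= n.+1)%N /\ forall t, p.[cos t] = cos (n%:R * t)) /\
  (exists p : {poly R},
    (size p <= n.+2)%N /\ forall t, p.[cos t] = cos (n.+1%:R * t)) by case.
elim: n => [|n [[p [sp pE]] [q [sq qE]]]].
  split.
    by exists 1; rewrite size_poly1; split=> // t; rewrite hornerC mul0r cos0.
  by exists 'X; rewrite size_polyX; split=> // t; rewrite hornerX mul1r.
split; first by exists q.
exists (2 *: ('X * q) - p); split=> [|t].
  rewrite (leq_trans (size_polyD _ _))// geq_max size_polyN.
  rewrite (leq_trans sp) ?andbT; last by rewrite !ltnS !leqW.
  rewrite (leq_trans (size_scale_leq _ _))// mulrC.
  by rewrite (leq_trans (size_polyMleq _ _))// size_polyX addn2.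
rewrite hornerD hornerN hornerZ hornerM hornerX pE qE -cosDcosB.
have -> : t + n.+1%:R * t = n.+2%:R * t by rewrite -[n.+2%:R]natr1; ring.
have -> : t - n.+1%:R * t = - (n%:R * t) by rewrite -natr1; ring.
by rewrite cosN addrK.
Qed.

Lemma cos_sum_poly (R : realType) (v : nat -> R) d : exists p : {poly R},
  (size p <= d)%N /\
  forall t, p.[cos t] = \sum_(0 <= j < d) v j * cos (j%:R * t).
Proof.
elim: d => [|d [p [sp pE]]].
  by exists 0; rewrite size_poly0; split=> // t; rewrite horner0 big_geq.
have [q [sq qE]] := cos_natmul_poly R d.
exists (p + v d *: q); split=> [|t].
  rewrite (leq_trans (size_polyD _ _))// geq_max (leq_trans sp)//=.
  by rewrite (leq_trans (size_scale_leq _ _)).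
by rewrite !hornerE pE qE big_nat_recr.
Qed.

(** Subtracting the multiple of the root product that agrees with [p] at [x1] leaves more roots than
    the degree allows. *)
Lemma poly_eq_prod_roots (F : fieldType) (p : {poly F}) (rs : seq F) (x1 : F) :
  (size p <= (size rs).+1)%N -> uniq (x1 :: rs) -> all (root p) rs ->
  forall x, p.[x] = p.[x1] * \prod_(y <- rs) ((x - y) / (x1 - y)).
Proof.
move=> sp /= /andP[x1rs urs] prs x.
pose P : {poly F} := \prod_(y <- rs) ('X - y%:P).
have PE z : P.[z] = \prod_(y <- rs) (z - y).
  by rewrite horner_prod; apply: eq_bigr => y _; rewrite hornerXsubC.
have P1 : P.[x1] != 0.
  rewrite PE prodf_seq_neq0; apply/allP => y yrs /=.
  by rewrite subr_eq0; apply: contra x1rs => /eqP ->.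
have : p - (p.[x1] / P.[x1]) *: P = 0.
  apply/eqP/negPn/negP => q0.
  have /(max_poly_roots q0) : all (root (p - (p.[x1] / P.[x1]) *: P)) (x1 :: rs).
    rewrite /= rootE !hornerE divfK// subrr eqxx/=.
    apply/allP => y yrs; rewrite rootE !hornerE (eqP (allP prs _ yrs)).
    have -> : P.[y] = 0 by apply/eqP; rewrite -rootE root_prod_XsubC.
    by rewrite mulr0 subrr.
  rewrite /= x1rs urs => /(_ isT); apply/negP; rewrite -leqNgt.
  rewrite (leq_trans (size_polyD _ _))// geq_max sp size_polyN.
  by rewrite (leq_trans (size_scale_leq _ _))// size_prod_XsubC.
move=> /eqP; rewrite subr_eq0 => /eqP ->; rewrite !hornerE divfK//.
by rewrite prodf_div -!PE mulrA mulrAC.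
Qed.

Lemma prod_reflect_ge0 (R : realDomainType) (h : nat -> R) N :
  (forall i, (i < N)%N -> 0 <= h i * h (N - i.+1)%N) ->
  (forall i, N = i.*2.+1 -> 0 <= h i) ->
  0 <= \prod_(0 <= i < N) h i.
Proof.
have [m] := ubnP N; elim: m N h => // m IH [|[|N]] h Nm hh hmid.
- by rewrite big_geq.
- by rewrite big_nat1 (hmid 0%N).
rewrite big_nat_recl// big_nat_recr//= mulrCA mulr_ge0//.
  apply: (IH N (h \o S)) => [|i iN|i iN] /=; first by lia.
    have := hh i.+1 ltac:(lia).
    by have -> : (N.+2 - i.+2 = (N - i.+1).+1)%N by lia.
  by apply: hmid; lia.
by have := hh 0%N isT; rewrite subn1.
Qed.

(** * Cosines on the regular [k]-gon: order and orthogonality *)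

Section CircleGrid.
Variables (R : realType) (k : nat).
Hypothesis k_gt0 : (0 < k)%N.

Local Notation ang n := (n%:R * (2 * (pi / k%:R)) : R).

Lemma cos_gridB m n : (n <= m)%N ->
  cos (ang n) - cos (ang m) =
  2 * (sin ((m + n)%:R * (pi / k%:R)) * sin ((m - n)%:R * (pi / k%:R))).
Proof.
move=> nm; rewrite -cosBcosD natrB// natrD.
by congr (cos _ - cos _); ring.
Qed.

Lemma cos_grid_eq m n : (n <= m)%N ->
  (cos (ang m) == cos (ang n)) = (k %| m + n)%N || (k %| m - n)%N.
Proof.
move=> nm; rewrite eq_sym -subr_eq0 cos_gridB// !mulf_eq0 pnatr_eq0/=.
by rewrite !sin_pin_eq0.
Qed.

Lemma cos_grid_opp m n : (k %| m + n)%N -> cos (ang m) = cos (ang n).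
Proof.
move=> kmn; case/orP: (leq_total m n) => mn; last first.
  by apply/eqP; rewrite cos_grid_eq// kmn.
by apply/esym/eqP; rewrite cos_grid_eq// addnC kmn.
Qed.

(** After [cos_gridB], the sums and the differences of indices each contribute two sines at
    consecutive multiples of [pi / k]. *)
Lemma cos_gridB_consecutive_ge0 n m :
  0 <= (cos (ang n) - cos (ang m)) * (cos (ang n) - cos (ang m.+1)).
Proof.
have [nm|mn] := leqP n m.
  rewrite !cos_gridB// ?(leqW nm)// mulrACA mulr_ge0//.
  by rewrite mulrACA mulr_ge0// ?addSn ?subSn// sin_pinS_ge0.
rewrite -opprB -[X in _ * X]opprB mulrNN !cos_gridB// 1?ltnW// mulrACA mulr_ge0//.
rewrite mulrACA mulr_ge0// ?addnS ?sin_pinS_ge0// mulrC.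
by rewrite -[(n - m)%N]prednK ?subn_gt0// -subnS sin_pinS_ge0.
Qed.

(** For odd [k], the indices [m] and [m.+1] are mirror images, the grid points closest to the angle
    [pi]. *)
Lemma cos_grid_min n m : (n < k)%N -> m.*2.+1 = k ->
  cos (ang m) <= cos (ang n).
Proof.
move=> nk mk; rewrite -subr_ge0; have [nm|mn] := leqP n m.
  by rewrite cos_gridB// !mulr_ge0// sin_pin_ge0//; lia.
have -> : cos (ang m) = cos (ang m.+1).
  by apply: cos_grid_opp; have -> : (m + m.+1 = k)%N by lia.
rewrite -opprB cos_gridB// -mulrN mulr_ge0// -mulNr mulr_ge0//; last first.
  by rewrite sin_pin_ge0//; lia.
have -> : (n + m.+1 = (n + m.+1 - k) + k)%N by lia.
have k0 : k%:R != 0 :> R by rewrite pnatr_eq0 -lt0n.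
rewrite natrD mulrDl [k%:R * _]mulrC divfK//.
by rewrite sinDpi opprK sin_pin_ge0//; lia.
Qed.

(** The products have frequencies [j + c] and [|j - c|], neither a multiple of [k] unless
    [j = c = 0]. The test [0 < d] covers the empty sum over [j]. *)
Lemma sum_cos_poly_grid (v : nat -> R) d c : (d <= k)%N ->
  c = 0%N \/ (d <= c <= k - d)%N ->
  \sum_(0 <= n < k) (\sum_(0 <= j < d) v j * cos (j%:R * ang n)) *
    cos (n%:R * ang c) =
  if (c == 0%N) && (0 < d)%N then k%:R * v 0%N else 0.
Proof.
move=> dk hc; under eq_bigr do rewrite mulr_suml.
rewrite exchange_big/=.
have term j : (j < d)%N -> (0 < j)%N || (0 < c)%N ->
    \sum_(0 <= n < k) v j * cos (j%:R * ang n) * cos (n%:R * ang c) = 0.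
  move=> jd jc; rewrite (eq_bigr (fun n : nat => v j / 2 *
      (cos (n%:R * (2 * ((j + c)%:R * (pi / k%:R))) + 0) +
       cos (n%:R * (2 * ((maxn j c - minn j c)%:R * (pi / k%:R))) + 0)))).
    by rewrite -mulr_sumr big_split/= !sum_cos_cyclic ?addr0 ?mulr0// gtnNdvd//; lia.
  move=> n _; rewrite !addr0 natrD natrB; last by lia.
  have -> : v j * cos (j%:R * ang n) * cos (n%:R * ang c) =
    v j / 2 * (2 * (cos (j%:R * ang n) * cos (n%:R * ang c))) by field.
  rewrite -cosDcosB; congr (_ * (cos _ + _)); first by ring.
  by have [jlc|clj] := leqP j c; [rewrite -cosN|]; congr cos; ring.
have [c0|c0] /= := eqVneq c 0%N.
  subst c; case: d dk hc term => [|d] dk hc term; first by rewrite big_geq.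
  rewrite big_nat_recl//= [X in _ + X]big1_seq ?addr0; last first.
    by move=> j; rewrite mem_index_iota => /andP[_ jd]; apply: (term j.+1).
  under eq_bigr do rewrite !mul0r mulr0 cos0 !mulr1.
  by rewrite sumr_const_nat subn0 mulr_natl.
by rewrite big1_seq// => j; rewrite mem_index_iota => /andP[_ jd]; apply: term; lia.
Qed.

End CircleGrid.

(** * Positivity of the coefficients, with [u] inverse to [d] modulo [k] *)

Section CircularTheta.
Variables (R : realType) (k d u w : nat).
Hypotheses (d_ge2 : (2 <= d)%N) (dk : (2 * d < k)%N).
Hypothesis duE : (d * u = k * w + 1)%N.

Local Notation ang n := (n%:R * (2 * (pi / k%:R)) : R).

Let psi : R := u%:R * (pi / k%:R).

Let k_gt0 : (0 < k)%N.
Proof. by rewrite (leq_trans _ dk)// ltnS. Qed.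

Let kR_neq0 : k%:R != 0 :> R.
Proof. by rewrite pnatr_eq0 -lt0n. Qed.

Lemma coprime_k_du : coprime k d /\ coprime k u.
Proof.
by apply/andP; rewrite -coprimeMr duE mulnC /coprime gcdnMDl gcdn1.
Qed.

Lemma sin_psi_neq0 j : (0 < j < k)%N -> sin (j%:R * psi) != 0.
Proof.
move=> /andP[j0 jk].
rewrite /psi mulrA -natrM sin_pin_eq0// Gauss_dvdl ?(proj2 coprime_k_du)//.
by rewrite gtnNdvd.
Qed.

(* Multiplication by [u] modulo [k] sends exactly 0, d and 2d to 0, 1 and 2. *)
Lemma mod_mul_u_ge3 i : (0 < i < d)%N -> (3 <= (i * u) %% k)%N.
Proof.
move=> /andP[i0 id]; set r := (_ %% k)%N; rewrite leqNgt; apply/negP => r2.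
have : (r * d = i %[mod k])%N.
  rewrite modnMml -mulnA [(u * d)%N]mulnC duE mulnDr muln1 mulnCA.
  by rewrite [(k * _)%N]mulnC modnMDl.
rewrite !modn_small; first by case: r r2 => [|[|[|]]]//; lia.
  by lia.
by rewrite (leq_ltn_trans _ dk)// leq_mul2r; apply/orP; right.
Qed.

Definition qratio (i : nat) : R :=
  - sin ((2 * d%:R - 1 - i%:R) * psi) / sin (i.+1%:R * psi).

Definition qbinomial (i : nat) : R := \prod_(0 <= l < i) qratio l.

Lemma qbinomial_rec i : (i < d)%N ->
  qbinomial i.+1 * sin (i.+1%:R * psi) =
  - (qbinomial i * sin ((2 * d%:R - 1 - i%:R) * psi)).
Proof.
move=> id; rewrite /qbinomial big_nat_recr//= -mulrA /qratio divfK ?mulrN//.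
by apply: sin_psi_neq0; lia.
Qed.

(* As [d psi = pi / k] modulo [pi], the numerator of [qratio l] equals
   [sin ((l + 1) psi - 2 pi / k)], of the same sign as the denominator. *)
Lemma qratio_gt0 l : (l.+1 < d)%N -> 0 < qratio l.
Proof.
move=> ld; set i := l.+1.
pose q := ((i * u) %/ k)%N; pose r := ((i * u) %% k)%N.
have rk : (r < k)%N by rewrite ltn_mod.
have r3 : (3 <= r)%N by apply: mod_mul_u_ge3.
have iE : (i * u)%:R = q%:R * k%:R + r%:R :> R.
  by rewrite -natrM -natrD -divn_eq.
have dE : d%:R * u%:R = k%:R * w%:R + 1 :> R by rewrite -!natrM natr1 duE addn1.
have -> : qratio l = sin ((r - 2)%:R * (pi / k%:R)) / sin (r%:R * (pi / k%:R)).
  rewrite /qratio -/i.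
  have -> : sin (i%:R * psi) = (-1) ^+ q * sin (r%:R * (pi / k%:R)).
    by rewrite /psi mulrA -natrM sin_modn.
  (* By [d * u = k * w + 1], [(2d - i) * u] is [2 - r] modulo [k]; [3 <= r] makes the truncated
     [r - 2] harmless. *)
  have -> : - sin ((2 * d%:R - 1 - l%:R) * psi) =
      (-1) ^+ q * sin ((r - 2)%:R * (pi / k%:R)).
    rewrite -sinDnpi -sinN.
    have -> : (r - 2)%:R * (pi / k%:R) + q%:R * pi =
       - ((2 * d%:R - 1 - l%:R) * psi) + (2 * w)%:R * pi.
      rewrite natrB ?(ltnW r3)// natrM /psi.
      have -> : (2 * d%:R - 1 - l%:R) * (u%:R * (pi / k%:R)) =
        (2 * (d%:R * u%:R) - (i * u)%:R) * (pi / k%:R) :> R.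
        by rewrite natrM /i -natr1; ring.
      by rewrite dE iE; field.
    by rewrite sinDnpi exprM sqrrN expr1n expr1n mul1r.
  by rewrite -mulf_div divff ?signr_eq0// mul1r.
by rewrite divr_gt0// sin_pin_gt0//; lia.
Qed.

Lemma qbinomial_gt0 i : (i < d)%N -> 0 < qbinomial i.
Proof.
elim: i => [_|i IH id]; first by rewrite /qbinomial big_geq.
by rewrite /qbinomial big_nat_recr//= mulr_gt0 ?qratio_gt0// IH// ltnW.
Qed.

Let coef := cos_coef d qbinomial.
Let V := cos_poly d qbinomial.
Let V0 : R := V 0.

Lemma coef_gt0 j : (j < d)%N -> 0 < coef j.
Proof.
move=> jd; rewrite /coef /cos_coef mulr_gt0//; first by case: ifP.
have [m dm] : exists m, (d - j = m.+1)%N by exists (d - j).-1; lia.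
rewrite dm big_nat_recl// ltr_wpDr ?qbinomial_gt0 ?(ltn_trans _ d_ge2)//.
rewrite big_seq sumr_ge0// => i; rewrite mem_index_iota => im.
by rewrite ltW// qbinomial_gt0//; lia.
Qed.

Lemma cos_poly_at0 : V0 = \sum_(0 <= j < d) coef j.
Proof. by apply: eq_bigr => j _; rewrite mulr0 cos0 mulr1. Qed.

Lemma cos_poly_at0_gt0 : 0 < V0.
Proof.
have [m dm] : exists m, d = m.+1 by exists d.-1; lia.
rewrite cos_poly_at0 [X in index_iota _ X]dm big_nat_recl//.
rewrite ltr_wpDr ?coef_gt0 ?dm// big_seq sumr_ge0// => i.
by rewrite mem_index_iota => im; rewrite ltW// coef_gt0//; lia.
Qed.

(** These [c] are the distances between adjacent vertices of the complement. Above [k - d], the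
    reflection [c -> k - c] reduces to the first range. *)
Lemma cos_poly_grid_root c : (0 < c < d)%N || (k - d < c < k)%N ->
  V (c%:R * (2 * psi)) = 0.
Proof.
have sn0 j : (0 < j < d)%N -> sin (j%:R * psi) != 0.
  by move=> jd; apply: sin_psi_neq0; lia.
case/orP => hc; first exact: (cos_poly_root qbinomial_rec).
rewrite -[RHS](@cos_poly_root _ _ _ _ qbinomial_rec (k - c))//; last by lia.
apply: eq_bigr => j _; congr (_ * _).
have angE n : j%:R * (n%:R * (2 * psi)) = ang (j * n * u)%N.
  by rewrite /psi !natrM; ring.
rewrite !angE; apply: cos_grid_opp => //.
rewrite -mulnDl -mulnDr subnKC; last by lia.
by rewrite mulnAC dvdn_mull.
Qed.

(** * The roots [a s] and the sign of the polynomial on the grid *)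

Let m (s : nat) : nat := (s * k %/ d)%N.
Let r (s : nat) : nat := (s * k %% d)%N.

(** Multiply by [d], which is prime to [k]: the identities [d * m s = s * k - r s] and
    [d * u = k * w + 1] leave a multiple of [k]. *)
Lemma beatty_mod s : (k %| m s + u * r s)%N.
Proof.
rewrite -(@Gauss_dvdr k d) ?(proj1 coprime_k_du)//.
have -> : (d * (m s + u * r s) = k * (s + w * r s))%N.
  have := divn_eq (s * k) d; rewrite -/(m s) -/(r s) => e.
  rewrite mulnDr mulnA duE mulnDl mul1n; lia.
exact: dvdn_mulr.
Qed.

Lemma beatty_rem s : (0 < s < d)%N -> (0 < r s < d)%N.
Proof.
move=> /andP[s0 sd]; rewrite /r ltn_mod lt0n.
rewrite -/(dvdn d (s * k)) Gauss_dvdl ?gtnNdvd ?s0 ?(ltnW d_ge2)//.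
by rewrite coprime_sym (proj1 coprime_k_du).
Qed.

Lemma beatty_gt0 s : (0 < s < d)%N -> (0 < m s < k)%N.
Proof.
move=> /andP[s0 sd]; rewrite /m divn_gt0 ?(ltnW d_ge2)//.
rewrite ltn_divLR ?(ltnW d_ge2)// [(k * d)%N]mulnC ltn_pmul2r// sd andbT.
by rewrite (leq_trans _ (leq_pmull k s0))// (leq_trans _ (ltnW dk))// leq_pmull.
Qed.

Lemma beatty_reflect s : (0 < s < d)%N -> (m (d - s) = k - (m s).+1)%N.
Proof.
move=> sd; have /andP[r0 rd] := beatty_rem sd; have /andP[m0 mk] := beatty_gt0 sd.
have e : ((d - s) * k = (k - (m s).+1) * d + (d - r s))%N.
  have := divn_eq (s * k) d; rewrite -/(m s) -/(r s); nia.
by rewrite /m e divnMDl ?(ltnW d_ge2)// divn_small ?addn0//; lia.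
Qed.

Let a s : R := cos (ang (m s)).

Lemma cos_beattyE s : a s = cos ((r s)%:R * (2 * psi)).
Proof.
rewrite /a (cos_grid_opp _ _ (beatty_mod s))//; congr cos.
by rewrite natrM /psi; ring.
Qed.

Lemma cos_beatty_neq1 s : (0 < s < d)%N -> 1 != a s.
Proof.
move=> sd; have /andP[m0 mk] := beatty_gt0 sd.
have -> : 1 = cos (ang 0%N) :> R by rewrite mul0r cos0.
by rewrite eq_sym cos_grid_eq// addn0 subn0 orbb gtnNdvd.
Qed.

Lemma cos_beatty_lt1 s : (0 < s < d)%N -> a s < 1.
Proof. by move=> sd; rewrite lt_neqAle eq_sym cos_beatty_neq1//= cos_le1. Qed.

(** Equal cosines make [k] divide the sum or the difference of the remainders. The sum is positive
    and below [2 * d < k], so the remainders agree, and [k] is invertible modulo [d]. *)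
Lemma cos_beatty_inj s t : (0 < s < d)%N -> (0 < t < d)%N -> a s = a t -> s = t.
Proof.
wlog rst : s t / (r s <= r t)%N.
  by move=> W sd td; case/orP: (leq_total (r s) (r t)) => rst e;
     [|apply/esym]; apply: W.
move=> sd td; have /andP[r0 rd] := beatty_rem sd.
have /andP[r0' rd'] := beatty_rem td.
have rE n : cos ((r n)%:R * (2 * psi)) = cos (ang (r n * u)%N).
  by congr cos; rewrite natrM /psi; ring.
rewrite !cos_beattyE !rE => /esym/eqP; rewrite cos_grid_eq// ?leq_mul2r ?rst ?orbT//.
rewrite -mulnDl -mulnBl !(Gauss_dvdl _ (proj2 coprime_k_du)).
rewrite gtnNdvd/=; [|by lia..].
move=> /dvdnP[[|q] rq]; last by nia.
have rr : (s * k == t * k %[mod d])%N by rewrite -/(r s) -/(r t); apply/eqP; lia.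
have kd : coprime d k by rewrite coprime_sym (proj1 coprime_k_du).
case/orP: (leq_total s t) => st.
  move: rr; rewrite eq_sym eqn_mod_dvd ?leq_mul2r ?st ?orbT// -mulnBl Gauss_dvdl//.
  by move=> /dvdnP[[|q] ?]; nia.
move: rr; rewrite eqn_mod_dvd ?leq_mul2r ?st ?orbT// -mulnBl Gauss_dvdl//.
by move=> /dvdnP[[|q] ?]; nia.
Qed.

(** Both sides are polynomials in [cos t] of degree below [d], with the [d - 1] distinct roots [a s]
    and value 1 at [t = 0]. *)
Lemma prod_beatty t :
  \prod_(1 <= s < d) ((cos t - a s) / (1 - a s)) = V t / V0.
Proof.
have [p [sp pE]] := cos_sum_poly coef d.
have VE x : V x = p.[cos x] by rewrite pE.
have p1 : p.[1] = V0 by rewrite /V0 VE cos0.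
rewrite VE (@poly_eq_prod_roots _ p [seq a s | s <- index_iota 1 d] 1).
- by rewrite big_map p1 mulrAC divff ?mul1r// gt_eqF// cos_poly_at0_gt0.
- by rewrite size_map size_iota subn1 prednK// ltnW.
- rewrite cons_uniq map_inj_in_uniq ?iota_uniq ?andbT.
    apply/mapP => -[s]; rewrite mem_index_iota => sd /eqP.
    by apply/negP/cos_beatty_neq1.
  move=> s t'; rewrite !mem_index_iota; exact: cos_beatty_inj.
- apply/allP => _ /mapP[s + ->]; rewrite mem_index_iota => sd.
  by rewrite rootE cos_beattyE -VE cos_poly_grid_root// beatty_rem.
Qed.

Lemma cos_poly_grid_ge0 n : (n < k)%N -> 0 <= V (ang n).
Proof.
move=> nk; rewrite -[V _](divfK (lt0r_neq0 cos_poly_at0_gt0)).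
rewrite mulr_ge0 ?(ltW cos_poly_at0_gt0)// -prod_beatty big_add1.
apply: prod_reflect_ge0 => [i id|i id].
  have si : (0 < i.+1 < d)%N by lia.
  have si' : (0 < (d.-1 - i.+1).+1 < d)%N by lia.
  have := cos_beatty_lt1 si; have := cos_beatty_lt1 si'.
  rewrite -subr_gt0 => pi'; rewrite -subr_gt0 => pi.
  rewrite mulrACA mulr_ge0//; last by rewrite mulr_ge0 ?invr_ge0 ?ltW.
  have e : ((d.-1 - i.+1).+1 = d - i.+1)%N by lia.
  have /andP[m0 mk] := beatty_gt0 si.
  (* The partner of [a s] has index [k - (m s).+1], hence the cosine of index [(m s).+1]: the two
     roots are consecutive on the grid. *)
  rewrite {2}/a e beatty_reflect//.
  rewrite (@cos_grid_opp _ _ _ (k - (m i.+1).+1)%N (m i.+1).+1)//.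
    exact: cos_gridB_consecutive_ge0.
  by rewrite subnK.
(* A central factor means [d = 2 * s]; then [beatty_reflect] gives [k = 2 * m s + 1], so [a s] is
   the least grid value. *)
have si : (0 < i.+1 < d)%N by lia.
rewrite divr_ge0 ?subr_ge0 ?(ltW (cos_beatty_lt1 si))// cos_grid_min//.
have /andP[m0 mk] := beatty_gt0 si.
have := beatty_reflect si; have -> : (d - i.+1 = i.+1)%N by lia.
by lia.
Qed.

(** * The semidefinite program: upper bound and attainment *)

Lemma cos_poly_distn (x y : nat) t :
  V (t * (x%:R - y%:R)) = V (`|x - y|%N%:R * t).
Proof.
apply: eq_bigr => j _; congr (_ * _).
have [yx|/ltnW xy] := leqP y x.
  by rewrite distnEl// natrB//; congr cos; ring.
by rewrite distnEr// natrB// -cosN; congr cos; ring.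
Qed.

Lemma cos_kernel_psd (I : finType) (f c : I -> R) (t : R) :
  0 <= \sum_x \sum_y c x * cos (t * (f x - f y)) * c y.
Proof.
have -> : \sum_x \sum_y c x * cos (t * (f x - f y)) * c y =
    (\sum_x c x * cos (t * f x)) ^+ 2 + (\sum_x c x * sin (t * f x)) ^+ 2.
  rewrite !expr2 !mulr_suml -big_split/=; apply: eq_bigr => x _.
  rewrite !mulr_sumr -big_split/=; apply: eq_bigr => y _.
  by rewrite mulrBr cosB; ring.
by rewrite addr_ge0 ?sqr_ge0.
Qed.

Lemma sum_cos_poly_circular c : c = 0%N \/ (d <= c <= k - d)%N ->
  \sum_(0 <= n < k) V (ang n) * cos (n%:R * ang c) =
  if c == 0%N then k%:R * coef 0 else 0.
Proof.
move=> hc; have dlek : (d <= k)%N by lia.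
by rewrite [LHS](sum_cos_poly_grid k_gt0 coef dlek hc) (ltnW d_ge2) andbT.
Qed.

(** Fourier duality: the transform [beta] of [B] and the grid values of [V] are nonnegative, so the
    sum of their products dominates its term at [n = 0], and that sum reduces to the trace. *)
Lemma theta_value_upper (B : 'I_k -> 'I_k -> R) :
  theta_feasible (complement_graph (@circular_complete k d)) B ->
  \sum_x \sum_y B x y <= k%:R * coef 0 / V0.
Proof.
move=> [[Bsym Bpsd] Btr B0]; rewrite ler_pdivlMr ?cos_poly_at0_gt0//.
pose beta (t : R) := \sum_x \sum_y B x y * cos (t * (x%:R - y%:R)).
have beta_ge0 t : 0 <= beta t.
  have := addr_ge0 (Bpsd (fun x => cos (t * x%:R))) (Bpsd (fun x => sin (t * x%:R))).
  rewrite -big_split/=; congr (_ <= _); apply: eq_bigr => x _.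
  rewrite -big_split/=; apply: eq_bigr => y _.
  by rewrite mulrBr cosB; ring.
have -> : (\sum_x \sum_y B x y) * V0 = V (ang 0%N) * beta (ang 0%N).
  rewrite mul0r mulrC; congr (_ * _); apply: eq_bigr => x _.
  by apply: eq_bigr => y _; rewrite mul0r cos0 mulr1.
have -> : k%:R * coef 0 = \sum_(0 <= n < k) V (ang n) * beta (ang n).
  transitivity (\sum_x \sum_y B x y * (\sum_(0 <= n < k) V (ang n) *
     cos (n%:R * ang `|x - y|%N))).
    transitivity ((\sum_x B x x) * (k%:R * coef 0)); first by rewrite Btr mul1r.
    rewrite mulr_suml; apply: eq_bigr => x _.
    (* Off the diagonal, orthogonality kills the distances from [d] to [k - d], and feasibility
       kills the others. *)
    rewrite (bigD1 x)//= sum_cos_poly_circular; last by rewrite distnn; left.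
    rewrite distnn/= big1 ?addr0// => y yx.
    have [xy|xy] := boolP (circular_complete d x y).
      move: xy; rewrite /circular_complete => xy.
      by rewrite sum_cos_poly_circular; [rewrite ifF ?mulr0//; lia|right].
    by rewrite B0 ?mul0r// /complement_graph eq_sym yx.
  under eq_bigr do under eq_bigr do rewrite mulr_sumr.
  under eq_bigr do rewrite exchange_big/=.
  rewrite exchange_big/=; apply: eq_bigr => n _.
  rewrite mulr_sumr; apply: eq_bigr => x _.
  rewrite mulr_sumr; apply: eq_bigr => y _.
  rewrite mulrCA; congr (_ * (_ * _)).
  have [yx|/ltnW xy] := leqP y x.
    by rewrite distnEl// natrB//; congr cos; ring.
  by rewrite distnEr// natrB// -cosN; congr cos; ring.
have [k' k'E] : exists k', k = k'.+1 by exists k.-1; lia.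
rewrite [X in index_iota _ X]k'E big_nat_recl// lerDl big_seq sumr_ge0// => n.
by rewrite mem_index_iota => nk; rewrite mulr_ge0// cos_poly_grid_ge0; lia.
Qed.

Lemma theta_value_attained :
  theta_values (complement_graph (@circular_complete k d)) (k%:R * coef 0 / V0).
Proof.
have V0_gt0 := cos_poly_at0_gt0.
have kV0_gt0 : 0 < k%:R * V0 by rewrite mulr_gt0 ?ltr0n.
(* Dividing by [k * V0] makes each diagonal entry [1 / k]; the angle [2 * psi] places roots of [V]
   on the complement edges. *)
exists (fun x y : 'I_k => V (2 * psi * (x%:R - y%:R)) / (k%:R * V0)).
  split.
  - split=> [x y|c]; first by rewrite !cos_poly_distn distnC.
    have -> : \sum_(x < k) \sum_(y < k)
        c x * (V (2 * psi * (x%:R - y%:R)) / (k%:R * V0)) * c y =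
      (\sum_(0 <= j < d) coef j * \sum_(x < k) \sum_(y < k)
         c x * cos (j%:R * (2 * psi) * (x%:R - y%:R)) * c y) / (k%:R * V0).
      under [in RHS]eq_bigr do rewrite mulr_sumr.
      under [in RHS]eq_bigr do under eq_bigr do rewrite mulr_sumr.
      rewrite [in RHS]exchange_big/= mulr_suml; apply: eq_bigr => x _.
      rewrite [in RHS]exchange_big/= mulr_suml; apply: eq_bigr => y _.
      rewrite mulrA mulrAC; congr (_ / _); rewrite /V /cos_poly mulr_sumr mulr_suml.
      by apply: eq_bigr => j _; rewrite -mulrA mulrCA !mulrA.
    rewrite divr_ge0 ?(ltW kV0_gt0)// big_seq sumr_ge0// => j.
    rewrite mem_index_iota => jd; rewrite mulr_ge0 ?cos_kernel_psd//.
    by rewrite ltW// coef_gt0.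
  - under eq_bigr do rewrite subrr mulr0.
    by rewrite sumr_const card_ord -[LHS]mulr_natl mulrA divff// gt_eqF.
  - move=> x y /andP[xy nxy]; rewrite cos_poly_distn cos_poly_grid_root ?mul0r//.
    have xk := ltn_ord x; have yk := ltn_ord y.
    move: nxy xy; rewrite /circular_complete -val_eqE/=; lia.
rewrite (_ : \sum_x _ = k%:R ^+ 2 * coef 0 / (k%:R * V0)).
  by have V0n := lt0r_neq0 V0_gt0; field; rewrite V0n.
under eq_bigr do rewrite -mulr_suml.
rewrite -mulr_suml; congr (_ / _).
transitivity (\sum_(0 <= j < d) coef j * \sum_(y < k) \sum_(x < k)
   cos (j%:R * (2 * psi) * (x%:R - y%:R))).
  under [in RHS]eq_bigr do rewrite mulr_sumr.
  under [in RHS]eq_bigr do under eq_bigr do rewrite mulr_sumr.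
  rewrite [RHS]exchange_big/= exchange_big/=; apply: eq_bigr => y _.
  rewrite [RHS]exchange_big/=; apply: eq_bigr => x _.
  by apply: eq_bigr => j _; rewrite mulrA.
have [d' d'E] : exists d', d = d'.+1 by exists d.-1; lia.
rewrite [X in index_iota _ X]d'E big_nat_recl//=.
(* For [0 < j < d], [k] does not divide [j * u], so the inner sums vanish and only the constant
   frequency remains. *)
rewrite [X in _ + X]big1_seq ?addr0; last first.
  move=> j; rewrite mem_index_iota => jd; rewrite big1 ?mulr0// => y _.
  rewrite -(big_mkord predT (fun x => cos (j.+1%:R * (2 * psi) * (x%:R - y%:R)))).
  rewrite -[RHS](@sum_cos_cyclic R k (j.+1 * u) (- (j.+1%:R * (2 * psi) * y%:R)))//.
    by apply: eq_bigr => x _; congr cos; rewrite natrM /psi; ring.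
  by rewrite Gauss_dvdl ?(proj2 coprime_k_du)// gtnNdvd//; lia.
under eq_bigr do under eq_bigr do rewrite !mul0r cos0.
by rewrite !(sumr_const, card_ord) -mulrnA -natrX mulrC mulnn.
Qed.

Lemma circular_theta : is_lovasz_theta
  (complement_graph (@circular_complete k d)) (k%:R * coef 0 / V0).
Proof.
split; first exact: theta_value_attained.
by move=> _ [B Bfeas <-]; exact: theta_value_upper.
Qed.

(** Orthogonality is applied on the regular [d]-gon, with [d] in place of [k]: all frequencies are
    below [d], so averaging keeps only the constant coefficient. *)
Lemma sum_prod_beatty :
  \sum_(0 <= n < d) \prod_(1 <= s < d)
    ((cos (n%:R * (2 * (pi / d%:R))) - a s) / (1 - a s)) = d%:R * coef 0 / V0.
Proof.
under eq_bigr do rewrite prod_beatty.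
rewrite -mulr_suml; congr (_ / _).
have d0 : (0 < d)%N by exact: ltnW.
have := @sum_cos_poly_grid R d d0 coef d 0 (leqnn d) (or_introl erefl).
rewrite eqxx d0 /= => <-; apply: eq_bigr => n _.
by rewrite mul0r mulr0 cos0 mulr1.
Qed.

End CircularTheta.

Theorem theorem1 (R : realType) (k d : nat)
    (hd : (2 <= d)%N) (hk : (2 * d <= k)%N) (hkd : gcdn k d = 1%N) :
  let c := fun n : nat => cos (2 * n%:R * pi / d%:R) : R in
  let a := fun n : nat => cos ((n * k %/ d)%N%:R * (2 * pi / k%:R)) : R in
  is_lovasz_theta (complement_graph (@circular_complete k d))
    (k%:R / d%:R *
       \sum_(0 <= n < d) \prod_(1 <= s < d) ((c n - a s) / (1 - a s))).
Proof.
move=> c a.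
(* If [k = 2 * d], the gcd would be [d], which is at least 2. *)
have dk : (2 * d < k)%N.
  rewrite ltn_neqAle hk andbT; apply/eqP => kE.
  by move: hkd; rewrite -kE gcdnC gcdnMl; lia.
have [u w duE _] := egcdnP k (ltnW hd).
have {}duE : (d * u = k * w + 1)%N by rewrite mulnC duE gcdnC hkd mulnC.
have d0 : d%:R != 0 :> R by rewrite pnatr_eq0; lia.
rewrite (_ : _ * _ = k%:R * cos_coef d (qbinomial R k d u) 0 /
    cos_poly d (qbinomial R k d u) 0); first exact: circular_theta duE.
under eq_bigr => n _.
  have -> : c n = cos (n%:R * (2 * (pi / d%:R))) by congr cos; field.
  under eq_bigr => s _ do rewrite /a -(mulrA 2).
  over.
by rewrite (sum_prod_beatty _ hd dk duE) -!mulrA mulKf.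
Qed.
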